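(* Let $p_0^N$ be a polynomial of degree $N\ge1$, let $p^N(z,\tau)$ be its heat evolution, and let $$S^N(z,\tau)=\frac1N\log|p^N(z,\tau)|^2 .$$ Then for all $(z,\tau)\in\mathbb{C}^2$ such that $z$ is not a root of $p^N(\cdot,\tau)$, $$\frac{\partial S^N}{\partial\tau}(z,\tau)=\frac12\left(\frac{\partial S^N}{\partial z}\right)^2+\frac1{2N}\frac{\partial^2S^N}{\partial z^2}.$$ Alternatively, in terms of the roots $\{z_j(\tau)\}_{j=1}^N$ of $p^N(\cdot,\tau)$ (listed with multiplicity), $$\frac{\partial S^N}{\partial\tau}(z,\tau)=\frac12\left(\frac{\partial S^N}{\partial z}\right)^2-\frac1{2N^2}\sum_{j=1}^N\frac1{(z-z_j(\tau))^2}.$$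
   Context: The heat evolution of $p_0^N$ is $p^N(z,\tau)=\exp\left(\frac\tau{2N}\frac{d^2}{dz^2}\right)p_0^N(z)=\sum_{k\ge0}\frac1{k!}\left(\frac\tau{2N}\right)^k\left(\frac{d^2}{dz^2}\right)^kp_0^N(z)$, $\tau\in\mathbb{C}$ (a terminating sum). Here $\partial/\partial\tau=\frac12(\partial_{\tau_1}-i\partial_{\tau_2})$ and $\partial/\partial z=\frac12(\partial_x-i\partial_y)$ are the Cauchy–Riemann operators, with $\tau=\tau_1+i\tau_2$, $z=x+iy$. *)

(* Defs.v *)
From mathcomp Require Import all_boot all_order all_algebra complex.
From mathcomp Require Import all_classical all_reals all_analysis.

Set Implicit Arguments.
Unset Strict Implicit.
Unset Printing Implicit Defensive.

Import Order.TTheory GRing.Theory Num.Theory.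
Import numFieldNormedType.Exports.

Local Open Scope ring_scope.
Local Open Scope complex_scope.

(* With [z = x + i y], a complex-valued [f] is differentiated in the real
   variables [x] and [y] through its real and imaginary parts. *)

Definition pderiv_x (R : realType) (f : R[i] -> R[i]) (z : R[i]) : R[i] :=
  derive1 (fun x : R => complex.Re (f (x +i* complex.Im z))) (complex.Re z)
  +i* derive1 (fun x : R => complex.Im (f (x +i* complex.Im z))) (complex.Re z).

Definition pderiv_y (R : realType) (f : R[i] -> R[i]) (z : R[i]) : R[i] :=
  derive1 (fun y : R => complex.Re (f (complex.Re z +i* y))) (complex.Im z)
  +i* derive1 (fun y : R => complex.Im (f (complex.Re z +i* y))) (complex.Im z).

(* [derive1] is total and takes a junk value where the derivative does not
   exist, so existence of the partial derivatives has to be asserted apart. *)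
Definition has_partials (R : realType) (f : R[i] -> R[i]) (z : R[i]) : Prop :=
  [/\ derivable (fun x : R => complex.Re (f (x +i* complex.Im z))) (complex.Re z) 1,
      derivable (fun x : R => complex.Im (f (x +i* complex.Im z))) (complex.Re z) 1,
      derivable (fun y : R => complex.Re (f (complex.Re z +i* y))) (complex.Im z) 1 &
      derivable (fun y : R => complex.Im (f (complex.Re z +i* y))) (complex.Im z) 1].

Definition wirtinger (R : realType) (f : R[i] -> R[i]) (z : R[i]) : R[i] :=
  2^-1 * (pderiv_x f z - (0 +i* 1) * pderiv_y f z).

(* The terms with [size p <= 2 * k] of the exponential series vanish, so the
   bound [k < size p] discards only zero terms. *)
Definition heat_evolution (R : realType) (N : nat) (p : {poly R[i]})
    (tau : R[i]) : {poly R[i]} :=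
  \sum_(k < size p)
    ((k`!)%:R^-1 * (tau / (2 * N%:R)) ^+ k) *: derivn (2 * k) p.

Definition log_potential (R : realType) (N : nat) (p0 : {poly R[i]})
    (z tau : R[i]) : R :=
  N%:R^-1 * ln (ComplexField.Normc.normc (heat_evolution N p0 tau).[z] ^+ 2).

Definition lists_roots (R : realType) (N : nat) (p : {poly R[i]})
    (zs : N.-tuple R[i]) : Prop :=
  forall a : R[i], count_mem a zs = mup a p.

(* Main.v *)
Require Import Defs.
From mathcomp Require Import all_boot all_order all_algebra complex.
From mathcomp Require Import all_classical all_reals all_analysis.
From mathcomp Require Import zify ring.

Set Implicit Arguments.
Unset Strict Implicit.
Unset Printing Implicit Defensive.

Import Order.TTheory GRing.Theory Num.Theory.
Import numFieldNormedType.Exports.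

Local Open Scope ring_scope.
Local Open Scope complex_scope.

(** Write [P] for the polynomial [p^N(., tau)].  Away from its zeros,
[log |P|^2] is locally [log P] plus its complex conjugate.  The Wirtinger
derivative kills the conjugate and sees only the holomorphic part, so
[dS/dz = N^-1 P'/P]; this is a quotient of polynomials, hence
[d^2S/dz^2 = N^-1 (P''P - P'^2)/P^2] by the ordinary quotient rule.  For fixed
[z] the value [p^N(z, tau)] is also a polynomial [Q] in [tau], so the same
computation gives [dS/dtau = N^-1 Q'(tau)/Q(tau)].  The exponential series
solves the heat equation [Q'(tau) = (2N)^-1 P''(z)], which turns this into
[N^-1 (2N)^-1 P''/P].  The first identity is then algebra: the term [P'^2/P^2]
in the second derivative of [S] cancels against the square of the first.

For the second identity, [P] splits as a constant times the product of the
[X - z_j], and the derivative of the logarithmic derivative [P'/P] of such a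
product is minus the sum of the [1/(z - z_j)^2].

The Wirtinger derivative is defined through real partial derivatives, so the
analytic part is a calculus of complex-valued functions of one real variable
([curve_derive]), applied to the horizontal and the vertical line through a
point.  The lemmas [wirtinger_log] and [wirtinger_ratio] sum it up for the two
kinds of functions needed; [heat_equation], [deriv2_log_prod_XsubC] and
[lists_rootsE] are the algebraic part. *)

(** * Real and imaginary parts *)

Definition sqnorm (R : realType) (w : R[i]) : R :=
  complex.Re w ^+ 2 + complex.Im w ^+ 2.

Lemma sqnorm_gt0 (R : realType) (w : R[i]) : w != 0 -> 0 < sqnorm w.
Proof.
case: w => a b; rewrite eq_complex negb_and /sqnorm /= => /orP[] h.
- by rewrite ltr_pwDl ?sqr_ge0 // exprn_even_gt0.
- by rewrite ltr_wpDl ?sqr_ge0 // exprn_even_gt0.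
Qed.

Lemma normc_sq (R : realType) (w : R[i]) :
  ComplexField.Normc.normc w ^+ 2 = sqnorm w.
Proof.
by case: w => a b; rewrite /= sqr_sqrtr // addr_ge0 ?sqr_ge0.
Qed.

Lemma ReM (R : realType) (v w : R[i]) : complex.Re (v * w) =
  complex.Re v * complex.Re w - complex.Im v * complex.Im w.
Proof. by case: v w => [a b] [c d]. Qed.

Lemma ImM (R : realType) (v w : R[i]) : complex.Im (v * w) =
  complex.Re v * complex.Im w + complex.Im v * complex.Re w.
Proof. by case: v w => [a b] [c d]. Qed.

Lemma ReD (R : realType) (v w : R[i]) :
  complex.Re (v + w) = complex.Re v + complex.Re w.
Proof. by case: v w => [a b] [c d]. Qed.

Lemma ImD (R : realType) (v w : R[i]) :
  complex.Im (v + w) = complex.Im v + complex.Im w.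
Proof. by case: v w => [a b] [c d]. Qed.

Lemma ReN (R : realType) (w : R[i]) : complex.Re (- w) = - complex.Re w.
Proof. by case: w. Qed.

Lemma ImN (R : realType) (w : R[i]) : complex.Im (- w) = - complex.Im w.
Proof. by case: w. Qed.

Lemma ReV (R : realType) (w : R[i]) :
  complex.Re w^-1 = complex.Re w / sqnorm w.
Proof. by case: w. Qed.

Lemma ImV (R : realType) (w : R[i]) :
  complex.Im w^-1 = - complex.Im w / sqnorm w.
Proof. by case: w => a b; rewrite mulNr. Qed.

Lemma complex_ext (R : realType) (v w : R[i]) :
  complex.Re v = complex.Re w -> complex.Im v = complex.Im w -> v = w.
Proof. by case: v w => [a b] [c d] /= -> ->. Qed.

(** * Derivatives of complex-valued functions of a real variable *)

(** Real and imaginary parts are differentiated separately, which is the form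
in which the partial derivatives of a complex function are defined. *)
Definition curve_derive (R : realType) (g : R -> R[i]) (t : R) (d : R[i]) :=
  is_derive t 1 (fun s => complex.Re (g s)) (complex.Re d) /\
  is_derive t 1 (fun s => complex.Im (g s)) (complex.Im d).

Lemma curve_derive_cst (R : realType) (c : R[i]) (t : R) :
  curve_derive (fun _ => c) t 0.
Proof. by split; exact: is_derive_cst. Qed.

Lemma curve_deriveD (R : realType) (g h : R -> R[i]) (t : R) (dg dh : R[i]) :
  curve_derive g t dg -> curve_derive h t dh ->
  curve_derive (fun s => g s + h s) t (dg + dh).
Proof.
move=> [g1 g2] [h1 h2]; split.
- by rewrite ReD; under eq_fun do rewrite ReD; exact: is_deriveD.
- by rewrite ImD; under eq_fun do rewrite ImD; exact: is_deriveD.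
Qed.

Lemma curve_deriveM (R : realType) (g h : R -> R[i]) (t : R) (dg dh : R[i]) :
  curve_derive g t dg -> curve_derive h t dh ->
  curve_derive (fun s => g s * h s) t (dg * h t + g t * dh).
Proof.
move=> [g1 g2] [h1 h2]; split.
- under eq_fun do rewrite ReM.
  have D := is_deriveB (is_deriveM g1 h1) (is_deriveM g2 h2).
  apply: (is_derive_eq D).
  by rewrite ReD !ReM /GRing.scale /=; ring.
- under eq_fun do rewrite ImM.
  have D := is_deriveD (is_deriveM g1 h2) (is_deriveM g2 h1).
  apply: (is_derive_eq D).
  by rewrite ImD !ImM /GRing.scale /=; ring.
Qed.

Lemma is_derive_sqnorm (R : realType) (g : R -> R[i]) (t : R) (d : R[i]) :
  curve_derive g t d ->
  is_derive t 1 (fun s => sqnorm (g s))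
    (2 * (complex.Re (g t) * complex.Re d + complex.Im (g t) * complex.Im d)).
Proof.
move=> [g1 g2]; have D := is_deriveD (is_deriveX 2 g1) (is_deriveX 2 g2).
apply: (is_derive_eq D).
by rewrite /GRing.scale /= !expr1; ring.
Qed.

Lemma curve_deriveV (R : realType) (g : R -> R[i]) (t : R) (d : R[i]) :
  g t != 0 -> curve_derive g t d ->
  curve_derive (fun s => (g s)^-1) t (- d / g t ^+ 2).
Proof.
move=> gt0 dg; have n0 := lt0r_neq0 (sqnorm_gt0 gt0).
have dn := is_deriveV (f := fun s => sqnorm (g s)) n0 (is_derive_sqnorm dg).
case: dg => g1 g2; split.
- under eq_fun do rewrite ReV.
  have D := is_deriveM g1 dn.
  apply: (is_derive_eq D).
  rewrite (expr2 (g t)) (invfM (g t)) !ReM !ImM !ReV !ImV !ReN !ImN.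
  rewrite /GRing.scale /=.
  move: n0; rewrite /sqnorm => n0; field; exact: n0.
- under eq_fun do rewrite ImV.
  have D := is_deriveM (is_deriveN g2) dn.
  apply: (is_derive_eq D).
  rewrite fctE (expr2 (g t)) (invfM (g t)) !ImM !ReM !ReV !ImV !ReN !ImN.
  rewrite /GRing.scale /=.
  move: n0; rewrite /sqnorm => n0; field; exact: n0.
Qed.

Lemma curve_derive_horner (R : realType) (p : {poly R[i]}) (g : R -> R[i])
    (t : R) (d : R[i]) :
  curve_derive g t d ->
  curve_derive (fun s => p.[g s]) t (p^`().[g t] * d).
Proof.
move=> dg; elim/poly_ind: p => [|p c IHp].
  rewrite deriv0 horner0 mul0r; under eq_fun do rewrite horner0.
  exact: curve_derive_cst.
under eq_fun do rewrite hornerMXaddC.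
have := curve_deriveD (curve_deriveM IHp dg) (curve_derive_cst c t).
congr curve_derive; rewrite derivMXaddC !hornerE /=; ring.
Qed.

Lemma is_derive_ln_sqnorm (R : realType) (g : R -> R[i]) (t : R) (d : R[i]) :
  g t != 0 -> curve_derive g t d ->
  is_derive t 1 (fun s => ln (sqnorm (g s))) (2 * complex.Re (d / g t)).
Proof.
move=> gt0 dg; have n_gt0 := sqnorm_gt0 gt0.
have D := is_derive1_comp (g := fun s => sqnorm (g s)) (is_derive1_ln n_gt0)
  (is_derive_sqnorm dg).
apply: (is_derive_eq D).
rewrite ReM ReV ImV; field; exact: lt0r_neq0.
Qed.

(** The logarithmic derivative is given by a quotient only where the denominator
does not vanish; differentiating it once more requires this to hold nearby. *)
Lemma near_curve_neq0 (R : realType) (g : R -> R[i]) (t : R) (d : R[i]) :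
  g t != 0 -> curve_derive g t d -> \near t, g t != 0.
Proof.
move=> gt0 /is_derive_sqnorm [dn _].
have cn : {for t, continuous (fun s => sqnorm (g s))}.
  by apply: differentiable_continuous; apply/derivable1_diffP.
have n_gt0 : \forall s \near t, 0 < sqnorm (g s).
  by move: cn => /cvgr_gt; apply; exact: sqnorm_gt0.
near=> s; have : 0 < sqnorm (g s) by near: s.
apply: contraTneq => ->.
by rewrite /sqnorm /= expr0n /= addr0 ltxx.
Unshelve. all: by end_near. Qed.

Lemma near_eq_curve_derive (R : realType) (g h : R -> R[i]) (t : R) (d : R[i]) :
  (\forall s \near t, g s = h s) -> curve_derive g t d -> curve_derive h t d.
Proof.
move=> gh [g1 g2]; split.
- by apply: near_eq_is_derive g1; apply: filterS gh => s ->.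
- by apply: near_eq_is_derive g2; apply: filterS gh => s ->.
Qed.

(** * Wirtinger derivatives *)

Lemma curve_derive_horizontal (R : realType) (z : R[i]) :
  curve_derive (fun x : R => x +i* complex.Im z) (complex.Re z) 1.
Proof. by split; [exact: is_derive_id | exact: is_derive_cst]. Qed.

Lemma curve_derive_vertical (R : realType) (z : R[i]) :
  curve_derive (fun y : R => complex.Re z +i* y) (complex.Im z) 'i.
Proof. by split; [exact: is_derive_cst | exact: is_derive_id]. Qed.

Lemma wirtingerP (R : realType) (f : R[i] -> R[i]) (z dx dy : R[i]) :
  curve_derive (fun x : R => f (x +i* complex.Im z)) (complex.Re z) dx ->
  curve_derive (fun y : R => f (complex.Re z +i* y)) (complex.Im z) dy ->
  has_partials f z /\ wirtinger f z = 2^-1 * (dx - 'i * dy).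
Proof.
case: dx dy => [a b] [c d] [/= a' b'] [/= c' d'].
split; first by split; exact: ex_derive.
by rewrite /wirtinger /pderiv_x /pderiv_y !derive1E !derive_val.
Qed.

(** Along a line with direction [v], the derivative of [ln |p|^2] is
[2 Re (v p'/p)].  With [v = 1] and [v = 'i] these are twice the real part of
[p'/p] and minus twice its imaginary part, and the Wirtinger combination
reassembles [p'/p] from them. *)
Lemma wirtinger_log (R : realType) (c : R) (p : {poly R[i]}) (z : R[i]) :
  p.[z] != 0 ->
  let f := fun w => (c * ln (ComplexField.Normc.normc p.[w] ^+ 2))%:C in
  has_partials f z /\ wirtinger f z = c%:C * (p^`().[z] / p.[z]).
Proof.
move=> pz0 f.
(* The curve [g] stands for the horizontal and the vertical line through [z]. *)
have log_curve (g : R -> R[i]) t d : g t = z -> curve_derive g t d ->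
    curve_derive (f \o g) t (c * (2 * complex.Re (p^`().[z] * d / p.[z])))%:C.
  move=> gt dg; split; last exact: is_derive_cst.
  rewrite /f /=; under eq_fun do rewrite normc_sq.
  have gt0 : p.[g t] != 0 by rewrite gt.
  have D := is_deriveZ c (is_derive_ln_sqnorm gt0 (curve_derive_horner p dg)).
  by rewrite gt in D.
have E : z = complex.Re z +i* complex.Im z by case: (z).
have [? ->] := wirtingerP (log_curve _ _ _ (esym E) (curve_derive_horizontal z))
  (log_curve _ _ _ (esym E) (curve_derive_vertical z)).
split=> //; set A := p^`().[z]; set B := p.[z].
(* What remains is [2 c L = 2 c Re L - 'i 2 c Re ('i L)], with [L = p'/p]. *)
rewrite -[RHS](mulKf (x := 2)) ?pnatr_eq0 //; congr (_ * _).
rewrite mulr_natl mulr2n mulr1 (mulrAC A); set L := A / B.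
apply: complex_ext.
  by rewrite !(ReD, ReN, ReM, ImM) /=; ring.
by rewrite !(ImD, ImN, ReM, ImM) /=; ring.
Qed.

(** A quotient of polynomials has derivative [D v] along direction [v] with [D]
given by the quotient rule, so the Wirtinger combination is
[(D - 'i ('i D)) / 2 = D].  The function [f] is only required to agree with the
quotient off the zeros of [p], because a Wirtinger derivative of [ln |p|^2]
is known only there. *)
Lemma wirtinger_ratio (R : realType) (c : R[i]) (p q : {poly R[i]})
    (f : R[i] -> R[i]) (z : R[i]) :
  p.[z] != 0 -> (forall w, p.[w] != 0 -> f w = c * (q.[w] / p.[w])) ->
  has_partials f z /\
  wirtinger f z = c * ((q^`().[z] * p.[z] - q.[z] * p^`().[z]) / p.[z] ^+ 2).
Proof.
move=> pz0 fE.
set D := RHS.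
have ratio_curve (g : R -> R[i]) t d : g t = z -> curve_derive g t d ->
    curve_derive (f \o g) t (D * d).
  move=> gt dg.
  have gt0 : p.[g t] != 0 by rewrite gt.
  have dp := curve_derive_horner p dg; have dq := curve_derive_horner q dg.
  have := curve_deriveM (curve_derive_cst c t)
    (curve_deriveM dq (curve_deriveV gt0 dp)).
  rewrite gt (_ : 0 * _ + _ = D * d); last by rewrite /D; field.
  apply: near_eq_curve_derive; apply: filterS (near_curve_neq0 gt0 dp) => s.
  by move=> /fE /= ->.
have E : z = complex.Re z +i* complex.Im z by case: (z).
have [? ->] := wirtingerP (ratio_curve _ _ _ (esym E) (curve_derive_horizontal z))
  (ratio_curve _ _ _ (esym E) (curve_derive_vertical z)).
split=> //.
have i2 : 'i * 'i = -1 :> R[i] by rewrite -expr2 sqr_i.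
rewrite mulr1 (mulrCA 'i D) i2 mulrN1 opprK; by field.
Qed.

(** * The heat equation *)

(** The heat evolution at a fixed point [z], as a polynomial in the time. *)
Definition heat_evolution_tau (R : realType) (N : nat) (p : {poly R[i]})
    (z : R[i]) : {poly R[i]} :=
  \sum_(k < size p)
    ((k`!)%:R^-1 * (2 * N%:R)^-1 ^+ k * (derivn (2 * k) p).[z]) *: 'X^k.

Lemma horner_heat_evolution_tau (R : realType) (N : nat) (p : {poly R[i]})
    (z tau : R[i]) :
  (heat_evolution_tau N p z).[tau] = (heat_evolution N p tau).[z].
Proof.
rewrite /heat_evolution_tau /heat_evolution !horner_sum.
by apply: eq_bigr => k _; rewrite !hornerE exprMn; ring.
Qed.

(** Differentiating in time shifts the exponential series by one index, and each
shift is worth two space derivatives.  The truncation is harmless: the last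
term on the space side is a derivative of order beyond the degree. *)
Lemma heat_equation (R : realType) (N : nat) (p : {poly R[i]}) (z tau : R[i]) :
  (heat_evolution_tau N p z)^`().[tau] =
    (2 * N%:R)^-1 * (heat_evolution N p tau)^`()^`().[z].
Proof.
rewrite /heat_evolution_tau /heat_evolution.
case En: (size p) => [|m]; first by rewrite !big_ord0 !deriv0 !horner0 mulr0.
rewrite big_ord_recl [in RHS]big_ord_recr.
rewrite derivD derivZ derivXn mulr0n scaler0 add0r.
(* [size p = m.+1] and the order of derivation is [2 * m + 2]. *)
have top0 : (derivn (2 * m) p)^`()^`() = 0.
  by rewrite -!derivnS; apply: derivn_poly0; rewrite En mul2n -addnn; lia.
rewrite !derivD !derivZ top0 scaler0 addr0.
have deriv_sum n (F : 'I_n -> {poly R[i]}) :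
  (\sum_(i < n) F i)^`() = \sum_(i < n) (F i)^`() by exact: raddf_sum.
rewrite !deriv_sum !horner_sum mulr_sumr.
apply: eq_bigr => k _; rewrite !derivZ derivXn.
rewrite (_ : (2 * lift ord0 k)%N = (2 * k).+2)%N; last by rewrite lift0; lia.
rewrite lift0 !derivnS !hornerZ hornerMn hornerXn -pred_Sn.
rewrite -[widen_ord _ _ : nat]/(k : nat).
rewrite factS natrM invfM exprMn exprS -(mulr_natr (tau ^+ k)).
have k1 : k.+1%:R != 0 :> R[i] by rewrite pnatr_eq0.
have kf : k`!%:R != 0 :> R[i] by rewrite pnatr_eq0 -lt0n fact_gt0.
move: (k.+1%:R) k1 (k`!%:R) kf => x x0 y y0.
move: ((2 * N%:R)^-1) (_.[z]) => b D.
by field; rewrite x0 y0.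
Qed.

(** * Roots *)

(** The identity [(q'/q)' = - \sum_a (z - a)^-2] with denominators cleared.  The
expression [q''q - q'^2] obeys, for [e = X - a],
[(e q)'' (e q) - (e q)'^2 = e^2 (q''q - q'^2) - q^2], which drives the
induction. *)
Lemma deriv2_log_prod_XsubC (F : fieldType) (s : seq F) (z : F) :
  let q := \prod_(a <- s) ('X - a%:P) in z \notin s ->
  q^`()^`().[z] * q.[z] - q^`().[z] ^+ 2 =
    - (q.[z] ^+ 2 * \sum_(a <- s) ((z - a) ^+ 2)^-1).
Proof.
move=> q; rewrite {}/q; elim: s => [|a s IHs].
  by move=> _; rewrite !big_nil -[1]/(1%:P) !derivC !hornerE; ring.
rewrite inE negb_or => /andP[za /IHs]; rewrite !big_cons.
set q := \prod_(_ <- _) _ => IH.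
have e0 : z - a != 0 by rewrite subr_eq0.
have derivE (r : {poly F}) : (('X - a%:P) * r)^`() = r + ('X - a%:P) * r^`().
  by rewrite derivM derivXsubC mul1r.
rewrite !(derivE, derivD) !(hornerXsubC, hornerD, hornerM).
set S := \sum_(_ <- _) _ in IH *.
transitivity
  ((z - a) ^+ 2 * (q^`()^`().[z] * q.[z] - q^`().[z] ^+ 2) - q.[z] ^+ 2).
  by ring.
by rewrite IH; field.
Qed.

(** A list of roots with the right multiplicities is a permutation of the one
given by algebraic closedness. *)
Lemma lists_rootsE (R : realType) (N : nat) (p : {poly R[i]})
    (zs : N.-tuple R[i]) :
  p != 0 -> lists_roots p zs ->
  p = lead_coef p *: \prod_(a <- zs) ('X - a%:P).
Proof.
move=> p0 zsP; have [r pE] := closed_field_poly_normal p.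
rewrite {1}pE; congr (_ *: _); apply: perm_big; apply/allP => a _ /=.
rewrite zsP pE -mul_polyC mupMr ?mu_prod_XsubC //.
by rewrite rootC lead_coef_eq0.
Qed.

Unset Implicit Arguments.
Set Strict Implicit.
Set Printing Implicit Defensive.

Theorem proposition4p1 (R : realType) (N : nat) (p0 : {poly R[i]})
    (hN : (1 <= N)%N) (hp0 : size p0 = N.+1) (z tau : R[i])
    (hz : ~~ root (heat_evolution N p0 tau) z) :
  let SN := fun w t : R[i] => (log_potential N p0 w t)%:C in
  let dS_dtau := wirtinger (fun t => SN z t) tau in
  let dS_dz := fun w => wirtinger (fun w' => SN w' tau) w in
  let d2S_dz2 := wirtinger dS_dz z in
  [/\ has_partials (fun t => SN z t) tau,
      has_partials (fun w => SN w tau) z,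
      has_partials dS_dz z,
      dS_dtau = 2^-1 * dS_dz z ^+ 2 + (2 * N%:R)^-1 * d2S_dz2 &
      forall zs : N.-tuple R[i], lists_roots (heat_evolution N p0 tau) zs ->
        dS_dtau = 2^-1 * dS_dz z ^+ 2
          - (2 * N%:R ^+ 2)^-1 * \sum_(j < N) ((z - tnth zs j) ^+ 2)^-1].
Proof.
move=> SN dS_dtau dS_dz d2S_dz2.
set P := heat_evolution N p0 tau.
have Pz0 : P.[z] != 0 by [].
have n0 : N%:R != 0 :> R[i] by rewrite pnatr_eq0 -lt0n.
have cE : (N%:R^-1)%:C = N%:R^-1 :> R[i] by rewrite fmorphV rmorph_nat.
have [tau_part tau_der] :
    has_partials (fun t => SN z t) tau /\
    dS_dtau = N%:R^-1 * ((2 * N%:R)^-1 * P^`()^`().[z] / P.[z]).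
  have Q0 : (heat_evolution_tau N p0 z).[tau] != 0.
    by rewrite horner_heat_evolution_tau.
  have := wirtinger_log N%:R^-1 Q0.
  rewrite heat_equation horner_heat_evolution_tau cE /dS_dtau.
  by under eq_fun do rewrite horner_heat_evolution_tau.
have z_der w : P.[w] != 0 -> has_partials (fun w' => SN w' tau) w /\
    dS_dz w = N%:R^-1 * (P^`().[w] / P.[w]).
  by move=> Pw0; rewrite -cE; exact: wirtinger_log.
have [zz_part zz_der] := wirtinger_ratio Pz0 (fun w Pw0 => (z_der w Pw0).2).
have [z_part zE] := z_der z Pz0.
have eqn : dS_dtau = 2^-1 * dS_dz z ^+ 2 + (2 * N%:R)^-1 * d2S_dz2.
  rewrite tau_der zE /d2S_dz2 zz_der.
  by field; rewrite n0 Pz0.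
split=> // zs zsP; rewrite eqn; congr (_ + _).
have P0 : P != 0 by apply: contraNneq Pz0 => ->; rewrite horner0.
have lc0 : lead_coef P != 0 by rewrite lead_coef_eq0.
have PE := lists_rootsE P0 zsP.
have z_zs : z \notin (zs : seq _).
  rewrite -root_prod_XsubC; apply: contra Pz0 => /rootP h.
  by rewrite PE hornerZ h mulr0.
have := deriv2_log_prod_XsubC z_zs.
set q := \prod_(_ <- _) _ in PE *; rewrite big_tuple; set S := \sum_(_ < _) _.
have q0 : q.[z] != 0.
  by move: Pz0; rewrite PE hornerZ mulf_eq0 negb_or => /andP[].
move=> h; rewrite /d2S_dz2 zz_der.
have -> : (P^`()^`().[z] * P.[z] - P^`().[z] * P^`().[z]) / P.[z] ^+ 2 = - S.
  (* The leading coefficient of [P] cancels. *)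
  rewrite PE !derivZ !hornerZ.
  transitivity ((q^`()^`().[z] * q.[z] - q^`().[z] ^+ 2) / q.[z] ^+ 2).
    by field; rewrite q0 lc0.
  by rewrite h; field.
by field.
Qed.
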